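(* Let $\mathbb{F}$ be an algebraically closed field of characteristic $\neq 2$. Any (non-zero) nilpotent Jordan algebra of dimension less than four over $\mathbb{F}$ is isomorphic to one of the following pairwise non-isomorphic algebras, all of which are associative ($J_{1,j}$ has basis $a$, $J_{2,j}$ has basis $a,b$, $J_{3,j}$ has basis $a,b,c$; only the non-zero products of basis elements are listed, up to commutativity): - $J_{1,1}$: all products zero. - $J_{2,1}$: all products zero. - $J_{2,2}: a^{2}=b$. - $J_{3,1}$: all products zero. - $J_{3,2}: a^{2}=b$. - $J_{3,3}: a\circ b=c$. - $J_{3,4}: a^{2}=b,\ a\circ b=c$.
   Context: A Jordan algebra over a field $\mathbb{F}$ is a commutative (not necessarily associative) $\mathbb{F}$-algebra $J$ with multiplication $\circ$ satisfying $x^{2}\circ(x\circ y)=x\circ(x^{2}\circ y)$ for all $x,y\in J$, where $x^2=x\circ x$. Put $J^{\langle 1\rangle}=J$ and $J^{\langle n\rangle}=J^{\langle n-1\rangle}\circ J$ (linear span of products); $J$ is nilpotent if $J^{\langle n\rangle}=0$ for some $n$. Products of basis elements not listed, and not obtained by commutativity, are zero. *)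

(* Defs.v *)
From HB Require Import structures.
From mathcomp Require Import all_boot all_order all_algebra.

Set Implicit Arguments.
Unset Strict Implicit.
Unset Printing Implicit Defensive.

Import GRing.Theory.
Local Open Scope ring_scope.

(* Finite-dimensional algebras, neither associative nor unital in general
   (the library's falgType is both). *)
Record algebra (F : fieldType) := Algebra {
  carrier :> vectType F;
  amul : {bilinear carrier -> carrier -> carrier}
}.

Declare Scope alg_scope.
Delimit Scope alg_scope with alg.
Notation "x ∘ y" := (amul _ x y)
  (at level 40, left associativity) : alg_scope.
Local Open Scope alg_scope.

Section Algebras.
Variable F : fieldType.
Implicit Types A B : algebra F.

Definition associative_alg A : Prop :=
  forall x y z : A, x ∘ (y ∘ z) = (x ∘ y) ∘ z.

Definition jordan A : Prop :=
  (forall x y : A, x ∘ y = y ∘ x) /\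
  (forall x y : A, (x ∘ x) ∘ (x ∘ y) = x ∘ ((x ∘ x) ∘ y)).

Definition isomorphic A B : Prop :=
  exists2 f : {linear A -> B},
    bijective f & forall x y : A, f (x ∘ y) = f x ∘ f y.

(* Same encoding as falgebra.prodv: it suffices to multiply basis vectors.
   By amul_spanP this is the linear span of all products. *)
Definition amul_span A (U V : {vspace A}) : {vspace A} :=
  <<[seq u ∘ v | u <- vbasis U, v <- vbasis V]>>%VS.

Lemma amul_spanP A (U V W : {vspace A}) :
  reflect {in U & V, forall u v, u ∘ v \in W} (amul_span U V <= W)%VS.
Proof.
apply: (iffP idP) => [sW u v Uu Vv | sW]; last first.
  apply/span_subvP=> _ /allpairsP[[u v] /= [Uu Vv ->]].
  by rewrite sW ?vbasis_mem.
rewrite (subvP sW) // (coord_vbasis Uu) (coord_vbasis Vv).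
rewrite linear_sumlz; apply: memv_suml => i _.
rewrite linear_sumr; apply: memv_suml => j _.
rewrite linearZl linearZr !memvZ // memv_span //.
by apply/allpairsP; exists ((vbasis U)`_i, (vbasis V)`_j); rewrite !memt_nth.
Qed.

(* J^<n>, meaningful for n >= 1. *)
Definition jpow A n : {vspace A} :=
  iter n.-1 (fun U => amul_span U fullv) fullv.

Definition nilpotent_alg A : Prop := exists n, jpow A n = 0%VS.

End Algebras.

(* A multiplication table t lists the triples (i, j, k) such that
   e_i ∘ e_j = e_k (read up to commutativity); all other products of basis
   vectors vanish. Each unordered pair {i, j} should occur at most once. *)
Definition mul_table := seq (nat * nat * nat).

Section Table.
Variables (F : fieldType) (n : nat) (t : mul_table).

Definition table_coef (i j k : nat) : F :=
  (((i, j, k) \in t) || ((j, i, k) \in t))%:R.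

Definition table_mul (x y : 'rV[F]_n) : 'rV[F]_n :=
  \row_k \sum_i \sum_j x 0 i * y 0 j * table_coef i j k.

Fact table_mul_bilinear : bilinear_for
  (GRing.Scale.Law.clone _ _ *:%R _) (GRing.Scale.Law.clone _ _ *:%R _)
  table_mul.
Proof.
split=> [y|x] a u v; apply/rowP=> k; rewrite !mxE mulr_sumr -big_split /=;
  apply: eq_bigr => i _; rewrite mulr_sumr -big_split /=;
  apply: eq_bigr => j _; rewrite !mxE.
  by rewrite !mulrDl !mulrA.
by rewrite mulrDr mulrDl !mulrA (mulrC (x 0 i)).
Qed.

HB.instance Definition _ :=
  bilinear_isBilinear.Build F _ _ _ _ _ table_mul table_mul_bilinear.

Definition table_alg : algebra F := @Algebra F 'rV[F]_n table_mul.

Lemma table_mul_delta i j :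
  table_mul (delta_mx 0 i) (delta_mx 0 j) = \row_k table_coef i j k.
Proof.
apply/rowP=> k; rewrite !mxE (bigD1 i) //= [X in _ + X]big1 => [|l /negPf nl].
  rewrite addr0 (bigD1 j) //= big1 => [|m /negPf nm].
    by rewrite addr0 !mxE !eqxx !mul1r.
  by rewrite !mxE nm andbF mulr0 mul0r.
by apply: big1 => m _; rewrite !mxE nl andbF !mul0r.
Qed.

End Table.

Inductive nilp_index := J11 | J21 | J22 | J31 | J32 | J33 | J34.

(* The basis vectors a, b, c are numbered 0, 1, 2. *)
Definition nilp_alg (F : fieldType) (k : nilp_index) : algebra F :=
  match k with
  | J11 => table_alg F 1 [::]
  | J21 => table_alg F 2 [::]
  | J22 => table_alg F 2 [:: (0, 0, 1)%N]
  | J31 => table_alg F 3 [::]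
  | J32 => table_alg F 3 [:: (0, 0, 1)%N]
  | J33 => table_alg F 3 [:: (0, 1, 2)%N]
  | J34 => table_alg F 3 [:: (0, 0, 1)%N; (0, 1, 2)%N]
  end.

(* Main.v *)
Require Import Defs.
From mathcomp Require Import all_boot all_order all_algebra.
From mathcomp Require Import ring.

(* For nilpotent J the chain J^<n> is strictly decreasing, so with
   dim J <= 3 only a few cases remain. If J^<3> <> 0, then J = <a> + J^<2>
   for some a, and the Jordan identity a^2 a^2 = a (a^2 a) forces
   a, a^2, a^3 to be a basis. If J^<3> = 0 <> J^<2>, some square a^2 is
   non-zero by polarization; in dimension 3, J^<2> is the line through a^2,
   and the product is a symmetric bilinear form of rank 1 or 2 on
   J / J^<2>, of which rank 2 is hyperbolic since the field is algebraically
   closed. The listed algebras are told apart by the dimension, the vanishing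
   of double and triple products, and whether x^2 = 0 implies x J = 0. *)

Set Implicit Arguments.
Unset Strict Implicit.
Unset Printing Implicit Defensive.

Import GRing.Theory passmx.
Local Open Scope ring_scope.
Local Open Scope alg_scope.

(** * Powers of an algebra and their strict descent under nilpotency *)

Section Powers.
Variables (F : fieldType) (A : algebra F).
Implicit Types (U V W : {vspace A}) (x y : A).

Lemma memv_amul_span U V x y : x \in U -> y \in V -> x ∘ y \in amul_span U V.
Proof. by move=> Ux Vy; apply: (amul_spanP _ _ _ (subvv _)). Qed.

Lemma amul_spanSl U V W : (U <= V)%VS -> (amul_span U W <= amul_span V W)%VS.
Proof.
by move=> /subvP sUV; apply/amul_spanP=> x y /sUV Vx Wy; apply: memv_amul_span.
Qed.

Lemma jpowS n : jpow A n.+2 = amul_span (jpow A n.+1) fullv.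
Proof. by []. Qed.

Lemma memv_jpowM n x y : x \in jpow A n.+1 -> x ∘ y \in jpow A n.+2.
Proof. by move=> Jx; rewrite jpowS memv_amul_span ?memvf. Qed.

Lemma memv_jpow2 x y : x ∘ y \in jpow A 2.
Proof. by rewrite memv_jpowM ?memvf. Qed.

Lemma memv_jpow3 x y z : (x ∘ y) ∘ z \in jpow A 3.
Proof. by rewrite memv_jpowM ?memv_jpow2. Qed.

Lemma jpow_sub n : (jpow A n.+2 <= jpow A n.+1)%VS.
Proof. by elim: n => [|n IHn]; [apply: subvf | apply: amul_spanSl]. Qed.

(** J^<n+1> is spanned by left-normed products of n+1 factors. In the induction the last factor [y]
    is absorbed by replacing [W] with its preimage under right multiplication by [y]. *)
Lemma jpow_foldl n W :
  (forall x (s : seq A), size s = n -> foldl (amul A) x s \in W) ->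
  (jpow A n.+1 <= W)%VS.
Proof.
elim: n W => [|n IHn] W sW; first by apply/subvP=> x _; apply: (sW x [::]).
apply/amul_spanP=> x y Jx _.
suff /subvP/(_ x Jx): (jpow A n.+1 <= linfun (applyr (amul A) y) @^-1: W)%VS.
  by rewrite -memv_preim lfunE.
apply: IHn => z s size_s; rewrite -memv_preim lfunE /= -foldl_rcons.
by rewrite sW // size_rcons size_s.
Qed.

Lemma nilpotent_foldl n :
  (forall x (s : seq A), size s = n -> foldl (amul A) x s = 0) ->
  nilpotent_alg A.
Proof.
move=> A0; exists n.+1; apply/eqP; rewrite -subv0; apply: jpow_foldl => x s sz.
by rewrite A0 ?mem0v.
Qed.

Hypothesis nilA : nilpotent_alg A.

(** Two equal consecutive powers make the chain stationary from there on; as some power is zero, the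
    stationary value is zero. *)
Lemma dim_jpowS n :
  jpow A n.+1 != 0%VS -> (\dim (jpow A n.+2) < \dim (jpow A n.+1))%N.
Proof.
move=> nz; rewrite ltnNge; apply: contraNN nz => le_dim.
have /eqP eqJ : jpow A n.+2 == jpow A n.+1 by rewrite eqEdim jpow_sub.
have stable m : jpow A (m + n).+1 = jpow A n.+1.
  by elim: m => // m IHm; rewrite addSn jpowS IHm.
have [m Jm0] := nilA; rewrite -(stable m) -subv0 -Jm0.
have mono k : (jpow A (k + m) <= jpow A m)%VS.
  elim: k => // k; apply: subv_trans; rewrite addSn.
  (* Index 0 is degenerate: [jpow A 0] and [jpow A 1] are both the whole space. *)
  by case: (k + m)%N => [|l]; rewrite ?subvf ?jpow_sub.
by rewrite addnC -addSn mono.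
Qed.

(** At least one dimension is lost at each step until the power vanishes; truncated subtraction
    covers the later steps. *)
Lemma dim_jpow n : (\dim (jpow A n.+1) <= \dim {:A} - n)%N.
Proof.
elim: n => [|n IHn]; first by rewrite subn0.
have [J0 | nz] := eqVneq (jpow A n.+1) 0%VS.
  have := dimvS (jpow_sub n); rewrite J0 dimv0 leqn0 => /eqP->.
  exact: leq0n.
have := leq_trans (dim_jpowS nz) IHn.
by rewrite subnS; case: (_ - n)%N.
Qed.

Lemma jpow_eq0 n : (\dim {:A} <= n)%N -> jpow A n.+1 = 0%VS.
Proof.
rewrite -subn_eq0 => /eqP dA; apply/eqP; rewrite -dimv_eq0 -leqn0 -dA.
exact: dim_jpow.
Qed.

(* Products modulo J^<3> only depend on the classes of the factors modulo
   J^<2>. *)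
Lemma jpow2_line a : (forall x y : A, x ∘ y = y ∘ x) ->
  ({:A} <= <[a]> + jpow A 2)%VS -> (jpow A 2 <= <[a ∘ a]> + jpow A 3)%VS.
Proof.
move=> mulC /subvP genA; apply/amul_spanP=> x y _ _.
have /memv_addP[_ /vlineP[s ->] [u J2u ->]] := genA x (memvf x).
have /memv_addP[_ /vlineP[t ->] [v J2v ->]] := genA y (memvf y).
rewrite linearDl linearDr -addrA memv_add //.
  by rewrite linearZl linearZr !memvZ ?memv_line.
by rewrite (mulC _ v) rpredD ?memv_jpowM.
Qed.

End Powers.

(** * Recognizing an algebra from the products of a basis *)

Section Isomorphism.
Variables (F : fieldType) (A : algebra F).

Lemma isomorphic_table n t (X : n.-tuple A) : basis_of fullv X ->
  (forall x y : A, x ∘ y = y ∘ x) ->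
  (forall i j : 'I_n, (i <= j)%N ->
     X`_i ∘ X`_j = \sum_(k < n) table_coef F t i j k *: X`_k) ->
  isomorphic A (table_alg F n t).
Proof.
move=> basisX mulC tX.
have table_coefC i j k : table_coef F t i j k = table_coef F t j i k.
  by rewrite /table_coef orbC.
have {}tX (i j : 'I_n) :
    X`_i ∘ X`_j = \sum_(k < n) table_coef F t i j k *: X`_k.
  have [/tX //|/ltnW/tX] := leqP i j; rewrite mulC => ->.
  by apply: eq_bigr => k _; rewrite table_coefC.
have dimA : n = \dim {:A} by rewrite (size_basis basisX).
subst n; exists (rVof X).
  by exists (vecof X); [apply: rVofK | apply: vecofK].
(* Multiplicativity is checked in [A], through the injective inverse [vecof X], by expanding both
   factors in the basis. *)
move=> x y; apply: (can_inj (vecofK basisX)); rewrite (rVofK basisX).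
rewrite -{1}(rVofK basisX x) -{1}(rVofK basisX y).
rewrite linear_sumlz; under eq_bigr do rewrite linear_sumr.
rewrite /vecof /= /table_mul; under [RHS]eq_bigr do rewrite mxE scaler_suml.
rewrite [RHS]exchange_big; apply: eq_bigr => i _ /=.
under [RHS]eq_bigr do rewrite scaler_suml.
rewrite [RHS]exchange_big; apply: eq_bigr => j _ /=.
rewrite linearZl linearZr tX /= !scaler_sumr; apply: eq_bigr => k _.
by rewrite !scalerA.
Qed.

End Isomorphism.

(** * Properties preserved by isomorphism *)

Section Invariants.
Variable F : fieldType.
Implicit Types A B : algebra F.

Definition zero_mul A := forall x y : A, x ∘ y = 0.
Definition zero_mul3 A := forall x y z : A, (x ∘ y) ∘ z = 0.
(** Tells [J32] from [J33], which agree in dimension and in the two conditions above: a square-zero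
    element of [J32] annihilates the algebra, whereas in [J33] a has square zero but a ∘ b = c. *)
Definition isotropic_annihilates A :=
  forall x y : A, x ∘ x = 0 -> x ∘ y = 0.

Lemma isomorphic_dim A B : isomorphic A B -> \dim {:A} = \dim {:B}.
Proof.
move=> [f bij_f _]; rewrite -(limg_ker_dim (linfun f) fullv) capfv.
have /eqP-> : lker (linfun f) == 0%VS.
  by apply/lker0P=> x y; rewrite !lfunE => /(bij_inj bij_f).
rewrite dimv0; congr (\dim _); apply/vspaceP=> y; rewrite memvf.
by have [g _ gK] := bij_f; rewrite -[y]gK -(lfunE f) memv_img ?memvf.
Qed.

Lemma isomorphic_invariants A B : isomorphic A B ->
  [/\ zero_mul A <-> zero_mul B, zero_mul3 A <-> zero_mul3 B
    & isotropic_annihilates A <-> isotropic_annihilates B].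
Proof.
move=> [f [g fK gK] fM].
have f_inj := can_inj fK.
have f0 x : (f x = 0) <-> (x = 0).
  by split=> [|->]; rewrite ?linear0 // -(linear0 f) => /f_inj.
split; split=> P0.
- by move=> x y; rewrite -[x]gK -[y]gK -fM P0 linear0.
- by move=> x y; apply/f0; rewrite fM.
- by move=> x y z; rewrite -[x]gK -[y]gK -[z]gK -!fM P0 linear0.
- by move=> x y z; apply/f0; rewrite !fM.
- move=> x y; rewrite -[x]gK -[y]gK -!fM => /f0/P0 xx.
  by rewrite xx linear0.
- by move=> x y /f0; rewrite fM => xx; apply/f0; rewrite fM P0.
Qed.

(** Both sides of the Jordan identity rebracket to x ∘ (x ∘ (x ∘ y)). *)
Lemma jordan_assoc A :
  (forall x y : A, x ∘ y = y ∘ x) -> associative_alg A -> jordan A.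
Proof. by move=> mulC mulA; split=> // x y; rewrite -!mulA. Qed.

End Invariants.

(** * Commutativity and nilpotency of table algebras *)

Section Tables.
Variables (F : fieldType) (n : nat) (t : mul_table).
Local Notation T := (table_alg F n t).

Lemma dim_table : \dim {:T} = n.
Proof. by rewrite dimvf /dim /= mul1n. Qed.

Lemma table_mulC (x y : T) : x ∘ y = y ∘ x.
Proof.
apply/rowP=> k; rewrite !mxE exchange_big; apply: eq_bigr => i _ /=.
apply: eq_bigr => j _; rewrite [x _ _ * _]mulrC; congr (_ * _).
by rewrite /table_coef orbC.
Qed.

(** Each product of basis vectors in the table has a larger index than its factors, so every further
    factor raises the lowest index that can occur. *)
Lemma table_foldl_graded :
  all (fun p => (p.1.1 < p.2)%N && (p.1.2 < p.2)%N) t ->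
  forall (x : T) (s : seq T) (k : 'I_n),
    (k < size s)%N -> foldl (amul T) x s 0 k = 0.
Proof.
move=> /allP t_lt x s; elim/last_ind: s => [//|s y IHs] k.
rewrite size_rcons ltnS foldl_rcons => le_ks.
rewrite mxE; apply: big1 => i _; apply: big1 => j _.
(* For i below [size s] the coordinate vanishes by induction; for the other i a table entry would
   force i < k, against k <= [size s] <= i. *)
have [lt_is | le_si] := ltnP i (size s); first by rewrite IHs ?mul0r.
rewrite /table_coef; case: orP => [tij|_]; last by rewrite mulr0.
have le_ki := leq_trans le_ks le_si.
by case: tij => /t_lt /= /andP[]; rewrite ![(i < k)%N]ltnNge le_ki.
Qed.

Lemma table_nilpotent :
  all (fun p => (p.1.1 < p.2)%N && (p.1.2 < p.2)%N) t -> nilpotent_alg T.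
Proof.
move=> t_lt; apply: (@nilpotent_foldl _ _ n) => x s size_s.
by apply/rowP=> k; rewrite table_foldl_graded ?size_s // mxE.
Qed.

End Tables.

(** * The seven listed algebras and the values of their invariants *)

Section NilpAlgebras.
Variable F : fieldType.
Local Notation o1 := (lift ord0 ord0).

Definition nilp_dim k :=
  match k with J11 => 1 | J21 | J22 => 2 | _ => 3 end%N.
Definition nilp_zero_mul k :=
  match k with J11 | J21 | J31 => true | _ => false end.
Definition nilp_zero_mul3 k :=
  match k with J34 => false | _ => true end.
Definition nilp_isotropic k :=
  match k with J33 | J34 => false | _ => true end.

Lemma dim_nilp_alg k : \dim {:nilp_alg F k} = nilp_dim k.
Proof. by case: k; exact: dim_table. Qed.

Lemma nilp_alg_mulC k (x y : nilp_alg F k) : x ∘ y = y ∘ x.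
Proof. by case: k x y => /=; apply: table_mulC. Qed.

Lemma nilp_alg_nilpotent k : nilpotent_alg (nilp_alg F k).
Proof. by case: k; exact: table_nilpotent. Qed.

Lemma zero_mul_table n : zero_mul (table_alg F n [::]).
Proof.
move=> x y; apply/rowP=> k; rewrite !mxE big1 // => i _.
by rewrite big1 // => j _; rewrite mulr0.
Qed.

(** Stated in every dimension at least 2, to serve both [J22] and [J32]. *)
Lemma table_mul_square n (x y : 'rV[F]_n.+2) :
  table_mul [:: (0, 0, 1)%N] x y
    = (x 0 ord0 * y 0 ord0) *: delta_mx 0 o1.
Proof.
apply/rowP=> k; rewrite !mxE big_ord_recl [X in _ + X]big1 => [|i _];
  last first.
  by apply: big1 => j _; rewrite /table_coef !inE !xpair_eqE /= andbF mulr0.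
rewrite addr0 big_ord_recl big1 => [|j _]; last first.
  by rewrite /table_coef !inE !xpair_eqE /= mulr0.
by rewrite addr0 /table_coef !inE !xpair_eqE /= orbb.
Qed.

(** The b-coordinate of x ∘ x is the square of the a-coordinate of x, through which alone x enters a
    product. *)
Lemma isotropic_square n :
  isotropic_annihilates (table_alg F n.+2 [:: (0, 0, 1)%N]).
Proof.
move=> x y; rewrite /= !table_mul_square => /rowP/(_ o1)/eqP.
by rewrite !mxE !eqxx mulr1 mulf_eq0 orbb => /eqP->; rewrite mul0r scale0r.
Qed.

Lemma zero_mul3_square n : zero_mul3 (table_alg F n.+2 [:: (0, 0, 1)%N]).
Proof.
by move=> x y z; rewrite /= !table_mul_square !mxE mulr0 mul0r scale0r.
Qed.

Lemma table_mul_hyperbolic (x y : 'rV[F]_3) :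
  table_mul [:: (0, 1, 2)%N] x y
    = (x 0 ord0 * y 0 o1 + x 0 o1 * y 0 ord0) *: delta_mx 0 ord_max.
Proof.
apply/rowP; case=> [[|[|[|//]]] ?];
  rewrite !(mxE, big_ord_recl, big_ord0) /table_coef /=; ring.
Qed.

Lemma table_mul_cube (x y : 'rV[F]_3) :
  table_mul [:: (0, 0, 1)%N; (0, 1, 2)%N] x y
    = (x 0 ord0 * y 0 ord0) *: delta_mx 0 o1
      + (x 0 ord0 * y 0 o1 + x 0 o1 * y 0 ord0) *: delta_mx 0 ord_max.
Proof.
apply/rowP; case=> [[|[|[|//]]] ?];
  rewrite !(mxE, big_ord_recl, big_ord0) /table_coef /=; ring.
Qed.

Lemma zero_mul_nilp_alg k : zero_mul (nilp_alg F k) <-> nilp_zero_mul k.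
Proof.
case: k; split=> //= Z; try exact: zero_mul_table.
- have /rowP/(_ ord_max)/eqP := Z (delta_mx 0 ord0) (delta_mx 0 ord0).
  by rewrite /= table_mul_delta !mxE oner_eq0.
- have /rowP/(_ o1)/eqP := Z (delta_mx 0 ord0) (delta_mx 0 ord0).
  by rewrite /= table_mul_delta !mxE oner_eq0.
- have /rowP/(_ ord_max)/eqP := Z (delta_mx 0 ord0) (delta_mx 0 o1).
  by rewrite /= table_mul_delta !mxE oner_eq0.
- have /rowP/(_ ord_max)/eqP := Z (delta_mx 0 ord0) (delta_mx 0 o1).
  by rewrite /= table_mul_delta !mxE oner_eq0.
Qed.

Lemma zero_mul3_nilp_alg k : zero_mul3 (nilp_alg F k) <-> nilp_zero_mul3 k.
Proof.
have zero3 A : zero_mul A -> @zero_mul3 F A by move=> Z x y z; rewrite Z.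
case: k; split=> //= Z; try exact/zero3/zero_mul_table;
  try exact: zero_mul3_square.
  move=> x y z; rewrite /= !table_mul_hyperbolic !mxE.
  by rewrite !mulr0 !mul0r addr0 scale0r.
(* In [J34], (a ∘ a) ∘ a = b ∘ a = c. *)
have /rowP/(_ ord_max)/eqP :=
  Z (delta_mx 0 ord0) (delta_mx 0 ord0) (delta_mx 0 ord0).
rewrite /= !table_mul_cube !mxE /= !(mulr0, mulr1, addr0, add0r).
by rewrite oner_eq0.
Qed.

Lemma isotropic_nilp_alg k :
  isotropic_annihilates (nilp_alg F k) <-> nilp_isotropic k.
Proof.
have zeroQ A : zero_mul A -> @isotropic_annihilates F A.
  by move=> Z x y; rewrite Z.
case: k; split=> //= Z; try exact/zeroQ/zero_mul_table.
- exact: isotropic_square.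
- exact: isotropic_square.
- have /(_ _)/rowP/(_ ord_max)/eqP := Z (delta_mx 0 ord0) (delta_mx 0 o1).
  rewrite /= !table_mul_hyperbolic !mxE /= !(mulr0, mulr1, addr0) scale0r.
  by rewrite oner_eq0 => ->.
(* In [J34], b ∘ b = 0 but b ∘ a = c. *)
- have /(_ _)/rowP/(_ ord_max)/eqP := Z (delta_mx 0 o1) (delta_mx 0 ord0).
  rewrite /= !table_mul_cube !mxE /=.
  rewrite !(mulr0, mul0r, mulr1, addr0, add0r) !scale0r addr0.
  by rewrite oner_eq0 => ->.
Qed.

(** Where triple products vanish both bracketings are zero; only [J34] needs a computation in
    coordinates. *)
Lemma nilp_alg_assoc k : associative_alg (nilp_alg F k).
Proof.
have assoc3 : nilp_zero_mul3 k -> associative_alg (nilp_alg F k).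
  move=> /zero_mul3_nilp_alg Z x y z.
  by rewrite nilp_alg_mulC !Z.
case: k assoc3 => [|||||| _ x y z]; try exact.
rewrite /= !table_mul_cube; apply/rowP=> k.
by rewrite !mxE /= !(mulr0, mulr1, addr0, add0r, mul0r) mulrA.
Qed.

Lemma nilp_alg_inj k l :
  isomorphic (nilp_alg F k) (nilp_alg F l) -> k = l.
Proof.
move=> iso; have eq_dim := isomorphic_dim iso; rewrite !dim_nilp_alg in eq_dim.
have iff_eq (b c : bool) : (b <-> c) -> b = c by case=> bc cb; apply/idP/idP.
have [] := isomorphic_invariants iso; rewrite !zero_mul_nilp_alg.
rewrite !zero_mul3_nilp_alg !isotropic_nilp_alg => /iff_eq + /iff_eq + /iff_eq.
by case: k l eq_dim {iso} => [] [].
Qed.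

End NilpAlgebras.

(** * Bases and multiplication tables in dimensions 2 and 3 *)

Section Bases.
Variables (F : fieldType) (A : algebra F).

Lemma basis_pair (a b : A) : \dim {:A} = 2 ->
  (forall r s, r *: a + s *: b = 0 -> r = 0 /\ s = 0) ->
  basis_of fullv [tuple a; b].
Proof.
move=> dimA indep; rewrite basisEfree dimA subvf leqnn !andbT.
apply/freeP=> k; rewrite !big_ord_recl big_ord0 addr0 /=.
move=> /indep[k0 k1] [[|[|//]] i_lt].
  by rewrite -[RHS]k0; congr k; apply: val_inj.
by rewrite -[RHS]k1; congr k; apply: val_inj.
Qed.

Lemma basis_triple (a b c : A) : \dim {:A} = 3 ->
  (forall r s t, r *: a + s *: b + t *: c = 0 -> [/\ r = 0, s = 0 & t = 0]) ->
  basis_of fullv [tuple a; b; c].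
Proof.
move=> dimA indep; rewrite basisEfree dimA subvf leqnn !andbT.
apply/freeP=> k; rewrite !big_ord_recl big_ord0 addr0 addrA /=.
move=> /indep[k0 k1 k2] [[|[|[|//]]] i_lt].
- by rewrite -[RHS]k0; congr k; apply: val_inj.
- by rewrite -[RHS]k1; congr k; apply: val_inj.
- by rewrite -[RHS]k2; congr k; apply: val_inj.
Qed.

Hypothesis mulC : forall x y : A, x ∘ y = y ∘ x.

Lemma isomorphic_zero_mul : (forall x y : A, x ∘ y = 0) ->
  isomorphic A (table_alg F (\dim {:A}) [::]).
Proof.
move=> A0; apply: (@isomorphic_table _ _ _ _ (vbasis fullv)) => //.
  exact: vbasisP.
by move=> i j _; rewrite A0 big1 // => k _; rewrite scale0r.
Qed.

Lemma isomorphic_table2 t (a b : A) :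
    let r i j := table_coef F t i j 0 *: a + table_coef F t i j 1 *: b in
    basis_of fullv [tuple a; b] ->
    [/\ a ∘ a = r 0 0, a ∘ b = r 0 1 & b ∘ b = r 1 1]%N ->
  isomorphic A (table_alg F 2 t).
Proof.
move=> r basisX [aa ab bb]; apply: (isomorphic_table basisX) => //.
by move=> [[|[|//]] ?] [[|[|//]] ?] //= _; rewrite !big_ord_recl big_ord0 addr0.
Qed.

Lemma isomorphic_table3 t (a b c : A) :
    let r i j := table_coef F t i j 0 *: a + table_coef F t i j 1 *: b
                   + table_coef F t i j 2 *: c in
    basis_of fullv [tuple a; b; c] ->
    [/\ a ∘ a = r 0 0, a ∘ b = r 0 1 & a ∘ c = r 0 2]%N ->
    [/\ b ∘ b = r 1 1, b ∘ c = r 1 2 & c ∘ c = r 2 2]%N ->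
  isomorphic A (table_alg F 3 t).
Proof.
move=> r basisX [aa ab ac] [bb bc cc]; apply: (isomorphic_table basisX) => //.
by move=> [[|[|[|//]]] ?] [[|[|[|//]]] ?] //= _;
   rewrite !big_ord_recl big_ord0 addr0 addrA.
Qed.

End Bases.

(** * Classification over an algebraically closed field *)

Section Classification.
Variables (F : closedFieldType) (A : algebra F).
Hypotheses (char_neq2 : 2%N \notin [pchar F]).
Hypotheses (jordanA : jordan A) (nilA : nilpotent_alg A).
Implicit Types a b c x y z : A.

Let mulC x y : x ∘ y = y ∘ x. Proof. by case: jordanA. Qed.
Let two_neq0 : 2%:R != 0 :> F.
Proof. by apply: contraNneq char_neq2 => two0; rewrite inE /= two0. Qed.

Lemma jpow2_eq0P : reflect (zero_mul A) (jpow A 2 == 0%VS).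
Proof.
apply: (iffP eqP) => [J2 x y | A0].
  by apply/eqP; rewrite -memv0 -J2 memv_jpow2.
by apply/eqP; rewrite -subv0; apply/amul_spanP=> x y _ _; rewrite A0 mem0v.
Qed.

(** Polarization over a finite, hence decidable, list of sums u + v of basis vectors. If all their
    squares vanish, u = v gives 4 (u ∘ u) = 0, and then the general case gives 2 (u ∘ v) = 0. *)
Lemma square_neq0 : ~ zero_mul A -> exists a, a ∘ a != 0.
Proof.
move=> nz; pose X := vbasis {:A}.
have [/hasP[a _ aa] | /hasPn sqX] :=
  boolP (has (fun x => x ∘ x != 0) [seq u + v | u <- X, v <- X]);
  first by exists a.
have {}sqX u v : u \in X -> v \in X -> (u + v) ∘ (u + v) = 0.
  by move=> Xu Xv; apply/eqP/negPn/sqX/allpairsP; exists (u, v).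
have double0 x : x + x = 0 -> x = 0.
  move/eqP; rewrite -mulr2n -scaler_nat scaler_eq0 (negPf two_neq0).
  by move/eqP.
have sq0 u : u \in X -> u ∘ u = 0.
  move=> Xu; have := sqX u u Xu Xu.
  by rewrite linearDl linearDr => /double0/double0.
case: nz; apply/jpow2_eq0P; rewrite -subv0; apply/span_subvP.
move=> _ /allpairsP[[u v] /= [Xu Xv ->]]; rewrite memv0; apply/eqP/double0.
have := sqX u v Xu Xv.
by rewrite linearDl !linearDr /= !sq0 // addr0 add0r (mulC v u).
Qed.

Lemma exists_sqrt (u : F) : exists v, v * v = u.
Proof.
(* The coefficients encode the equation v^2 = u + 0 v. *)
have [v] := @solve_monicpoly F 2 (fun i => if i == 0%N then u else 0) isT.
rewrite !big_ord_recl big_ord0 /= mulr1 mul0r !addr0 expr2; by exists v.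
Qed.

Lemma jpow3_eq0P : reflect (zero_mul3 A) (jpow A 3 == 0%VS).
Proof.
apply: (iffP eqP) => [J3 x y z | A0].
  by apply/eqP; rewrite -memv0 -J3 memv_jpow3.
apply/eqP; rewrite -subv0; apply: jpow_foldl => x [|y [|z []]] // _.
by rewrite /= A0 mem0v.
Qed.

Lemma jpow4_eq0 x y z t : (\dim {:A} <= 3)%N -> ((x ∘ y) ∘ z) ∘ t = 0.
Proof.
move=> dimA; apply/eqP; rewrite -memv0 -(jpow_eq0 nilA dimA).
by rewrite memv_jpowM ?memv_jpow3.
Qed.

(** Triple products vanish in dimension 2, so multiplying r a + s a^2 = 0 by a leaves r a^2 = 0;
    hence a and a^2 form a basis. *)
Lemma isomorphic_J22 : \dim {:A} = 2 -> ~ zero_mul A ->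
  isomorphic A (nilp_alg F J22).
Proof.
move=> dimA /square_neq0[a aa_neq0].
have A3 x y z : (x ∘ y) ∘ z = 0.
  by apply/jpow3_eq0P; rewrite (jpow_eq0 nilA) ?dimA.
apply: (@isomorphic_table2 _ _ mulC _ a (a ∘ a)).
  apply: basis_pair => // r s rs0.
  have /eqP : (r *: a + s *: (a ∘ a)) ∘ a = 0 by rewrite rs0 linear0l.
  rewrite linearDl !linearZl /= A3 scaler0 addr0 scaler_eq0 (negPf aa_neq0).
  rewrite orbF => /eqP r0; split=> //; apply/eqP.
  by move/eqP: rs0; rewrite r0 scale0r add0r scaler_eq0 (negPf aa_neq0) orbF.
by rewrite /table_coef /= !scale0r scale1r !add0r [a ∘ (a ∘ a)]mulC !A3.
Qed.

(** Strict descent provides a vector outside J^<2>; as the codimension is at most one, any such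
    vector spans a supplement. *)
Lemma jpow2_supplement_line : (\dim {:A} <= (\dim (jpow A 2)).+1)%N ->
  (0 < \dim {:A})%N -> exists a, ({:A} <= <[a]> + jpow A 2)%VS.
Proof.
move=> dimA A_gt0; have lt_dim : (\dim (jpow A 2) < \dim {:A})%N.
  by apply: (@dim_jpowS _ _ nilA 0); rewrite -dimv_eq0 -lt0n.
have /subvPn[a _ aJ2] : ~~ ({:A} <= jpow A 2)%VS.
  by apply: contraL lt_dim => /dimvS; rewrite leqNgt.
exists a; have: (jpow A 2 <= <[a]> + jpow A 2)%VS by apply: addvSr.
move/dimv_leqif_sup => le_dim.
suff: (\dim {:A} <= \dim (<[a]> + jpow A 2))%N.
  by rewrite -(geq_leqif (dimv_leqif_sup (subvf _))).
apply: leq_trans dimA _; rewrite (ltn_leqif le_dim) subv_add.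
by rewrite -memvE (negPf aJ2).
Qed.

Lemma isomorphic_J34 : \dim {:A} = 3 -> ~ zero_mul3 A ->
  isomorphic A (nilp_alg F J34).
Proof.
move=> dimA /jpow3_eq0P nzJ3.
have dimA_le3 : (\dim {:A} <= 3)%N by rewrite dimA.
have J3mul0 u y : u \in jpow A 3 -> u ∘ y = 0.
  move=> J3u; apply/eqP; rewrite -memv0 -(jpow_eq0 nilA dimA_le3).
  exact: memv_jpowM.
(* J^<3> non-zero forces J^<2> to have dimension at least 2 by strict descent. *)
have [a genA] : exists a, ({:A} <= <[a]> + jpow A 2)%VS.
  apply: jpow2_supplement_line; rewrite dimA // ltnS.
  have nzJ2 : jpow A 2 != 0%VS.
    by apply: contraNneq nzJ3 => J2; rewrite -subv0 -J2 jpow_sub.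
  apply: leq_trans (dim_jpowS nilA nzJ2).
  by rewrite ltnS lt0n dimv_eq0.
have /subvP genJ2 := jpow2_line mulC genA.
(* The Jordan identity at x = y = a turns a^2 a^2 into a left-normed product of four factors, which
   lies in J^<4> = 0. *)
have sq_sq0 : (a ∘ a) ∘ (a ∘ a) = 0.
  by have [_ ->] := jordanA; rewrite mulC jpow4_eq0.
(* J^<2> is spanned by a^2 and J^<3>, and J^<3> annihilates J. If also a^2 a = 0, then a^2 kills
   both a and J^<2>, hence all of J, and J^<3> would be zero. *)
have cube_neq0 : (a ∘ a) ∘ a != 0.
  apply: contraNneq nzJ3 => cube0.
  have sq_mul0 v : v \in jpow A 2 -> (a ∘ a) ∘ v = 0.
    move=> /genJ2/memv_addP[_ /vlineP[q ->] [w J3w ->]].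
    by rewrite mulC linearDl linearZl /= sq_sq0 scaler0 (J3mul0 w) // addr0.
  rewrite -subv0; apply/amul_spanP=> x y /genJ2 + _.
  case/memv_addP=> _ /vlineP[r ->] [u J3u ->].
  have := subvP genA y (memvf y).
  case/memv_addP=> _ /vlineP[s ->] [v J2v ->].
  rewrite linearDl linearZl /= (J3mul0 u) // linearDr linearZr /= cube0.
  by rewrite sq_mul0 // !(scaler0, addr0) mem0v.
pose b := a ∘ a; pose c := b ∘ a.
have cM x : c ∘ x = 0 by apply: jpow4_eq0.
have bb : b ∘ b = 0 := sq_sq0.
have ab : a ∘ b = c := mulC _ _.
have c_neq0 : c != 0 := cube_neq0.
apply: (@isomorphic_table3 _ _ mulC _ a b c).
  apply: basis_triple => // r s t rst0.
  (* Multiplying the relation by b leaves r c = 0; multiplying the rest by a then leaves s c = 0. *)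
  have r0 : r = 0.
    have /eqP : (r *: a + s *: b + t *: c) ∘ b = 0 by rewrite rst0 linear0l.
    rewrite !linearDl !linearZl /= ab bb cM !scaler0 !addr0 scaler_eq0.
    by rewrite (negPf c_neq0) orbF => /eqP.
  move: rst0; rewrite r0 scale0r add0r => st0.
  have s0 : s = 0.
    have /eqP : (s *: b + t *: c) ∘ a = 0 by rewrite st0 linear0l.
    rewrite !linearDl !linearZl /= cM scaler0 addr0 scaler_eq0.
    by rewrite (negPf c_neq0) orbF => /eqP.
  move/eqP: st0; rewrite s0 scale0r add0r scaler_eq0 (negPf c_neq0) orbF.
  by move/eqP.
all: rewrite /table_coef /= !(scale0r, scale1r, add0r, addr0).
  by rewrite ab [a ∘ c]mulC cM.
by rewrite bb [b ∘ c]mulC !cM.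
Qed.

(** If J^<2> had dimension 2 or more, a single a would generate J modulo J^<2>, and J^<2> would lie
    in the line of a^2 because J^<3> = 0. *)
Lemma jpow2_line_square : \dim {:A} = 3 -> ~ zero_mul A -> zero_mul3 A ->
  exists2 a, a ∘ a != 0 & forall x y, exists r, x ∘ y = r *: (a ∘ a).
Proof.
move=> dimA nz /jpow3_eq0P/eqP J3.
have dimJ2 : (\dim (jpow A 2) <= 1)%N.
  rewrite leqNgt; apply/negP=> J2_gt1.
  have [||a /(jpow2_line mulC)] := jpow2_supplement_line; rewrite ?dimA //.
  rewrite J3 addv0 => /dimvS; rewrite dim_vline leqNgt.
  by rewrite (leq_ltn_trans _ J2_gt1) ?leq_b1.
have [a aa] := square_neq0 nz; exists a => // x y; apply/vlineP.
suff <- : jpow A 2 = <[a ∘ a]>%VS by apply: memv_jpow2.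
by apply/esym/eqP; rewrite eqEdim -memvE memv_jpow2 dim_vline aa.
Qed.

Lemma isomorphic_J32_J33 : \dim {:A} = 3 -> ~ zero_mul A -> zero_mul3 A ->
  isomorphic A (nilp_alg F J32) \/ isomorphic A (nilp_alg F J33).
Proof.
move=> dimA nz A3; have [a + sqA] := jpow2_line_square dimA nz A3.
set c := a ∘ a in sqA * => c_neq0.
have cM x : c ∘ x = 0 by apply: A3.
have Mc x : x ∘ c = 0 by rewrite mulC.
have /subvPn[b0 _ b0_notin] : ~~ ({:A} <= <[a]> + <[c]>)%VS.
  apply/negP=> /dimvS; rewrite dimA leqNgt ltnS.
  rewrite (leq_trans (dimv_add_leqif _ _)) // !dim_vline.
  by rewrite (leq_add (leq_b1 _) (leq_b1 _)).
(* One Gram-Schmidt step for the form defined by x ∘ y = r c, which takes the value 1 at (a, a). *)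
have [l ab0] := sqA a b0; pose b := b0 - l *: a.
have ab : a ∘ b = 0 by rewrite linearBr linearZr /= ab0 subrr.
have ba : b ∘ a = 0 by rewrite mulC.
have indep r s t : r *: a + s *: b + t *: c = 0 -> [/\ r = 0, s = 0 & t = 0].
  move=> rst0.
  have r0 : r = 0.
    have /eqP : (r *: a + s *: b + t *: c) ∘ a = 0 by rewrite rst0 linear0l.
    rewrite !linearDl !linearZl /= ba cM !scaler0 !addr0 scaler_eq0.
    by rewrite (negPf c_neq0) orbF => /eqP.
  have s0 : s = 0.
    (* A relation with s non-zero would express b0 through a and c. *)
    apply: contraNeq b0_notin => s_neq0.
    have -> : b0 = l *: a + (- (s^-1 * t)) *: c.
      apply: (canRL (subrKC _)); apply/eqP; rewrite scaleNr -addr_eq0.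
      rewrite -(can_eq (scalerK s_neq0)) scaler0 scalerDr scalerA mulVKf //.
      by move: rst0; rewrite r0 scale0r add0r => ->.
    by rewrite memv_add ?memvZ ?memv_line.
  move/eqP: rst0; rewrite r0 s0 !scale0r !add0r scaler_eq0 (negPf c_neq0) orbF.
  by move/eqP.
(* The form is now diagonal with entries 1 and d: rank 1 if d = 0, rank 2 otherwise. *)
have [d bb] := sqA b b.
have [d0 | d_neq0] := eqVneq d 0; [left | right].
- rewrite d0 scale0r in bb; apply: (@isomorphic_table3 _ _ mulC _ a c b).
    apply: basis_triple => // r s t; rewrite addrAC => /indep[].
    by split.
  by rewrite /table_coef /= !(scale0r, scale1r, add0r, addr0) ab Mc.
  by rewrite /table_coef /= !(scale0r, scale1r, add0r, addr0) bb !cM.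
(* [w ∘ w = - (a ∘ a)] and [a ∘ w = 0], so [a + w] and [a - w] are isotropic. *)
- have [v vv] := exists_sqrt (- d^-1); pose w := v *: b.
  have aw : a ∘ w = 0 by rewrite linearZr /= ab scaler0.
  have wa : w ∘ a = 0 by rewrite mulC.
  have ww : w ∘ w = - c.
    rewrite linearZl linearZr /= bb !scalerA vv mulNr mulVf //.
    by rewrite scaleN1r.
  have v_neq0 : v != 0.
    by apply: contraNneq d_neq0 => v0; rewrite -invr_eq0 -oppr_eq0 -vv v0 mul0r.
  (* The third vector is the product (a + w) ∘ (a - w) = c - w ∘ w = c + c. *)
  apply: (@isomorphic_table3 _ _ mulC _ (a + w) (a - w) (c + c)).
    apply: basis_triple => // r s t rst0.
    (* These are the coefficients of the relation on a, b and c; since 2 and v are non-zero, they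
       determine r, s and t. *)
    have [|rs0 rs0' t0] := indep (r + s) ((r - s) * v) (t + t).
      rewrite -rst0 -scalerA -/w !scalerDl !scalerDr scaleNr scalerN.
      by congr (_ + _); rewrite addrACA.
    have /eqP := rs0'; rewrite mulf_eq0 (negPf v_neq0) orbF subr_eq0 => /eqP rs.
    have double0 (x : F) : x + x = 0 -> x = 0.
      by move/eqP; rewrite -mulr2n -mulr_natl mulf_eq0 (negPf two_neq0) => /eqP.
    by split; apply: double0 => //; [rewrite {2}rs | rewrite -{1}rs].
  rewrite /table_coef /= !(scale0r, scale1r, add0r, addr0).
  rewrite !(linearDl, linearDr, linearNl, linearNr) /= !aw !wa ww !Mc.
  by split; rewrite ?(addr0, add0r, opprK, subrr, oppr0).
  rewrite /table_coef /= !(scale0r, scale1r, add0r, addr0).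
  rewrite !(linearDl, linearDr, linearNl, linearNr) /= !aw !wa ww !Mc.
  by split; rewrite ?(addr0, add0r, oppr0, opprK, subrr).
Qed.

End Classification.

(** * Case division by dimension and by the vanishing of J^<2> and J^<3> *)

Theorem theorem5p1 (F : closedFieldType) (char_neq2 : 2%N \notin [pchar F]) :
  (forall A : algebra F, jordan A -> nilpotent_alg A ->
     (0 < \dim {:A} < 4)%N ->
     exists k : nilp_index, isomorphic A (nilp_alg F k)) /\
  (forall k l : nilp_index,
     isomorphic (nilp_alg F k) (nilp_alg F l) -> k = l) /\
  (forall k : nilp_index,
     jordan (nilp_alg F k) /\ nilpotent_alg (nilp_alg F k) /\
     associative_alg (nilp_alg F k)).
Proof.
split; [|split; first exact: nilp_alg_inj].
  move=> A jA nA dimA.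
  have [/jpow2_eq0P A0 | /jpow2_eq0P nz2] := boolP (jpow A 2 == 0%VS).
    have := isomorphic_zero_mul jA.1 A0.
    case: (\dim {:A}) dimA => [|[|[|[|]]]] // _ isoA.
    - by exists J11.
    - by exists J21.
    - by exists J31.
  (* In dimension 1 strict descent already makes J^<2> zero. *)
  have dimA_ge2 : (1 < \dim {:A})%N.
    rewrite ltnNge; apply/negP=> /(jpow_eq0 nA) J2.
    by case: nz2; apply/jpow2_eq0P; rewrite J2.
  have [dim2 | dim_neq2] := eqVneq (\dim {:A}) 2.
    by exists J22; apply: isomorphic_J22.
  have dim3 : \dim {:A} = 3.
    by case: (\dim {:A}) dimA dimA_ge2 dim_neq2 => [|[|[|[|]]]].
  have [/jpow3_eq0P A3 | /jpow3_eq0P nz3] := boolP (jpow A 3 == 0%VS).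
    by have [] := isomorphic_J32_J33 char_neq2 jA nA dim3 nz2 A3;
      [exists J32 | exists J33].
  by exists J34; apply: isomorphic_J34.
move=> k; split; last first.
  by split; [apply: nilp_alg_nilpotent | apply: nilp_alg_assoc].
by apply: jordan_assoc; [apply: nilp_alg_mulC | apply: nilp_alg_assoc].
Qed.
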